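(* For every nonnegative integer $d$ there exists a constant $C_d>0$, depending only on $d$, such that the following holds. Let $n\ge d$ ($n\geq 1$), $k\ge 1$ and $r\ge 0$ be integers, and let $F\in\mathcal{S}^k[x]$ be a symmetric polynomial matrix of degree $d$ in $x=(x_1,\dots,x_n)$, not identically zero on $\{0,1\}^n$. If $(r+1)/n\le 1/2$ and $d(d+1)\cdot\xi^n_{r+1}/n\le 1/2$, then $$\frac{F_{\min}-F_{(r)}}{\|F\|_\infty}\le 2C_d\cdot\xi^n_{r+1}/n .$$
   Context: Write $\mathbb{B}^n=\{0,1\}^n$. $\mathcal{S}^k$ is the space of real symmetric $k\times k$ matrices and $\mathcal{S}^k[x]$ the space of polynomials in $x=(x_1,\dots,x_n)$ with coefficients in $\mathcal{S}^k$. For $A\in\mathcal{S}^k$, $\|A\|$ is the spectral norm and $\lambda_{\min}(A)$ the smallest eigenvalue. For $F\in\mathcal{S}^k[x]$ put $$F_{\min}:=\min_{x\in\mathbb{B}^n}\lambda_{\min}(F(x)),\qquad \|F\|_\infty:=\max_{x\in\mathbb{B}^n}\|F(x)\|.$$ $\Sigma^{k\times k}_r$ is the set of polynomial matrices $S\in\mathcal{S}^k[x]$ of the form $S(x)=\sum_i U_i(x)U_i(x)^\top$ (finite sum), where $U_i\in\mathbb{R}^{k\times m}[x]$ for some $m\in\mathbb{N}$ and $\deg U_i\le r$. The outer Lasserre bound is $$F_{(r)}:=\sup\{\lambda\in\mathbb{R}:\exists S\in\Sigma^{k\times k}_r,\ F(x)-\lambda I=S(x)\ \forall x\in\mathbb{B}^n\}.$$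 The Krawtchouk polynomial of degree $j$ with parameter $n$ is $\mathcal{K}^n_j(t)=\sum_{i=0}^j(-1)^i\binom{t}{i}\binom{n-t}{j-i}$. For $1\le j\le n$, $\xi^n_j$ denotes its least (smallest real) root. *)

(* Defs.v *)
From mathcomp Require Import all_boot all_order all_algebra.
(* mpoly must be imported before the mathcomp-analysis files: in the other
   order its notations are rejected. *)
From mathcomp Require Import mpoly.
From mathcomp Require Import classical_sets reals constructive_ereal ereal.

Set Implicit Arguments.
Unset Strict Implicit.
Unset Printing Implicit Defensive.

Import Order.TTheory GRing.Theory Num.Theory.

Local Open Scope classical_set_scope.
Local Open Scope ring_scope.

Definition cube (n : nat) := {ffun 'I_n -> bool}.

Definition polymx (R : realType) (n k m : nat) := 'M[{mpoly R[n]}]_(k, m).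

Definition mxeval (R : realType) (n k m : nat) (F : polymx R n k m)
    (x : cube n) : 'M[R]_(k, m) :=
  \matrix_(i, j) (F i j).@[fun l => (x l)%:R].

(* [msize] is 1 + total degree, and 0 on the zero polynomial, so the zero
   matrix gets degree 0. *)
Definition mxdeg (R : realType) (n k m : nat) (F : polymx R n k m) : nat :=
  (\max_(i < k) \max_(j < m) (msize (F i j)).-1)%N.

Definition enorm (R : realType) (k : nat) (v : 'cV[R]_k) : R :=
  Num.sqrt (\sum_(i < k) v i ord0 ^+ 2).

Definition spectral_norm (R : realType) (k : nat) (A : 'M[R]_k) : R :=
  sup [set enorm (A *m v) | v in [set v : 'cV[R]_k | enorm v = 1]].

(* For symmetric A of positive size the spectrum is finite and nonempty, so
   the infimum is a minimum. *)
Definition lambda_min (R : realType) (k : nat) (A : 'M[R]_k) : R :=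
  inf [set a : R | eigenvalue A a].

(* The cube is finite and nonempty: [inf] and [sup] are a minimum and a
   maximum here. *)
Definition Fmin (R : realType) (n k : nat) (F : polymx R n k k) : R :=
  inf [set lambda_min (mxeval F x) | x in [set: cube n]].

Definition norm_infty (R : realType) (n k : nat) (F : polymx R n k k) : R :=
  sup [set spectral_norm (mxeval F x) | x in [set: cube n]].

Definition sos (R : realType) (n k r : nat) (S : polymx R n k k) : Prop :=
  exists (N : nat) (m : 'I_N -> nat) (U : forall i, polymx R n k (m i)),
    (forall i, (mxdeg (U i) <= r)%N) /\ S = \sum_(i < N) U i *m (U i)^T.

(* The supremum is extended-real because no feasible value exists when r is
   too small, in which case it is -oo. *)
Definition outer_bound (R : realType) (n k r : nat) (F : polymx R n k k)
    : \bar R :=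
  ereal_sup [set l%:E | l in [set l : R |
    exists2 S : polymx R n k k, sos r S &
      forall x : cube n, mxeval F x - l%:M = mxeval S x]].

(* p (p - 1) ... (p - i + 1) / i!  *)
Definition poly_binom (R : realType) (p : {poly R}) (i : nat) : {poly R} :=
  (i`!%:R)^-1 *: \prod_(l < i) (p - (l%:R)%:P).

Definition krawtchouk (R : realType) (n j : nat) : {poly R} :=
  \sum_(i < j.+1) (-1) ^+ i *:
    (poly_binom 'X i * poly_binom ((n%:R)%:P - 'X) (j - i)).

(* Meaningful for 1 <= j <= n, when the set of real roots is finite and
   nonempty. *)
Definition kraw_root (R : realType) (n j : nat) : R :=
  inf [set t : R | root (krawtchouk R n j) t].

(* Main.v *)
(* Kernel method. On functions on the cube let a radial kernel
   [g (dist x y)] act by [f |-> \sum_y g (dist x y) f y]; it multiplies the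
   degree-[i] Fourier level of [f] by an eigenvalue [lam i]. For
   [g = q ^+ 2], with [q] proportional to [K / (X - xi)], [K] the Krawtchouk
   polynomial of degree [r + 1] and [xi] its least root, orthogonality gives
   [\sum_w g (wt w) = 1] and [\sum_w g (wt w) wt w = xi], whence
   [0 <= 1 - lam i <= 2 i xi / n]. Applying the inverse multiplier to
   [F - Fmin + eps] perturbs it by at most [eps = O(xi / n) ||F||], because the
   levels of a function of degree [d] are bounded by its sup norm with a
   constant depending on [d] only (noise operators are contractions, and the
   levels are the coefficients of a polynomial in the noise parameter). The
   result is pointwise positive semidefinite, so the kernel writes
   [F - Fmin + eps] as a sum of squares of degree [r]. *)
Require Import Defs.
From mathcomp Require Import all_boot all_order all_algebra.
From mathcomp Require Import mpoly.
From mathcomp Require Import boolp classical_sets reals constructive_ereal ereal.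
From mathcomp Require Import ring lra.

Set Implicit Arguments.
Unset Strict Implicit.
Unset Printing Implicit Defensive.

Import Order.TTheory GRing.Theory Num.Theory.

Local Open Scope ring_scope.

(** * Characters of the cube *)

Section Characters.
Variables (R : comNzRingType) (n : nat).
Implicit Types (s t x y z w : cube n) (f : cube n -> R) (a : nat -> R).

Definition wt x : nat := (\sum_l x l)%N.

Definition cube0 : cube n := [ffun=> false].

Definition xor x y : cube n := [ffun l => x l (+) y l].

(** The sign is a product over coordinates so that sums over the cube factor through
    [sum_cube_prod]. *)
Definition chi s x : R := \prod_l (-1) ^+ (s l && x l).

Definition fourier f s : R := \sum_x f x * chi s x.

Lemma sum_cube_prod (phi : 'I_n -> bool -> R) :
  \sum_(x : cube n) \prod_l phi l (x l) = \prod_l (phi l true + phi l false).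
Proof. by rewrite -bigA_distr_bigA; apply: eq_bigr => l _; rewrite big_bool. Qed.

Lemma xorK x : involutive (xor x).
Proof. by move=> y; apply/ffunP => l; rewrite !ffunE addKb. Qed.

Lemma wt_cube0 : wt cube0 = 0%N.
Proof. by rewrite /wt big1 // => l _; rewrite ffunE. Qed.

Lemma wt_le x : (wt x <= n)%N.
Proof.
by rewrite -[leqRHS]card_ord -sum1_card; apply: leq_sum => l _; case: (x l).
Qed.

Lemma wt_xor_eq0 x y : (wt (xor x y) == 0)%N = (x == y).
Proof.
rewrite sum_nat_eq0; apply/forallP/eqP => [h|-> l]; last by rewrite ffunE addbb.
by apply/ffunP => l; have := h l; rewrite ffunE; case: (x l); case: (y l).
Qed.

Lemma chiC s x : chi s x = chi x s.
Proof. by apply: eq_bigr => l _; rewrite andbC. Qed.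

Lemma chi_xor s x y : chi s (xor x y) = chi s x * chi s y.
Proof.
rewrite -big_split; apply: eq_bigr => l _ /=; rewrite ffunE.
by case: (s l); case: (x l); case: (y l); rewrite /= ?(expr0, expr1); ring.
Qed.

End Characters.

Lemma prod_if_wt (R : comNzRingType) n (x : cube n) (a b : R) :
  \prod_l (if x l then a else b) = a ^+ wt x * b ^+ (n - wt x).
Proof.
have -> : (n - wt x = \sum_l ~~ x l)%N.
  apply/eqP; rewrite -(eqn_add2l (wt x)) subnKC ?wt_le // -big_split /=.
  rewrite -[X in X == _]card_ord -sum1_card; apply/eqP/eq_bigr => l _.
  by case: (x l).
rewrite -!prodrXr -big_split; apply: eq_bigr => l _ /=.
by case: (x l); rewrite !(expr0, expr1) ?(mul1r, mulr1).
Qed.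

(** * Fourier analysis, radial convolution and degree *)

Section Fourier.
Variables (R : comNzRingType) (n : nat).
Implicit Types (s t x y z w : cube n) (f : cube n -> R) (a : nat -> R).

(** The sum over [s] factors: coordinate [l] contributes [1 - 'X] if [x l] holds and [1 + 'X]
    otherwise. Evaluation yields the noise kernel, coefficient extraction the Krawtchouk values. *)
Lemma chi_generating x :
  \sum_s (chi R s x)%:P * 'X^(wt s) =
    (1 - 'X) ^+ wt x * (1 + 'X) ^+ (n - wt x) :> {poly R}.
Proof.
rewrite -prod_if_wt.
transitivity (\sum_(s : cube n) \prod_l
    (((-1) ^+ (s l && x l))%:P * 'X^(s l) : {poly R})).
  apply: eq_bigr => s _; rewrite big_split /= prodrXr; congr (_ * _).
  by rewrite /chi rmorph_prod.
rewrite (sum_cube_prod (fun l b => ((-1) ^+ (b && x l))%:P * 'X^b : {poly R})).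
apply: eq_bigr => l _; case: (x l); rewrite /= !(expr0, expr1) ?polyCN; ring.
Qed.

Lemma chi_noise (rho : R) x :
  \sum_s rho ^+ wt s * chi R s x = (1 - rho) ^+ wt x * (1 + rho) ^+ (n - wt x).
Proof.
have /(congr1 (fun p => p.[rho])) := chi_generating x.
rewrite horner_sum !hornerE => <-.
by apply: eq_bigr => s _; rewrite !hornerE mulrC.
Qed.

(** At [rho = 1] the factor [(1 - rho) ^+ wt x] of [chi_noise] vanishes unless [x] has weight 0. *)
Lemma sum_chi_l x : \sum_s chi R s x = (x == cube0 n)%:R * 2 ^+ n.
Proof.
have := chi_noise 1 x; under eq_bigr do rewrite expr1n mul1r.
move=> ->; rewrite subrr expr0n.
have -> : (wt x == 0)%N = (x == cube0 n).
  rewrite -(wt_xor_eq0 x); congr (wt _ == _).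
  by apply/ffunP => l; rewrite !ffunE addbF.
case: eqVneq => [->|_]; last by rewrite !mul0r.
by rewrite wt_cube0 subn0.
Qed.

Lemma chi_orth x y : \sum_s chi R s x * chi R s y = (x == y)%:R * 2 ^+ n.
Proof.
under eq_bigr do rewrite -chi_xor; rewrite sum_chi_l; congr (_%:R * _).
rewrite -(wt_xor_eq0 x) -(wt_xor_eq0 _ (cube0 n)); congr (nat_of_bool (wt _ == _)).
by apply/ffunP => l; rewrite !ffunE addbF.
Qed.

Lemma fourier_inversion f y : \sum_s fourier f s * chi R s y = 2 ^+ n * f y.
Proof.
under eq_bigr do rewrite mulr_suml; rewrite exchange_big /=.
under eq_bigr => x _.
  under eq_bigr do rewrite -mulrA; rewrite -mulr_sumr chi_orth.
  over.
rewrite (bigD1 y) //= eqxx mul1r big1 ?addr0 1?mulrC // => x /negPf ->.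
by rewrite mul0r mulr0.
Qed.

Lemma sum_chi_level s j :
  \sum_(w | wt w == j) chi R s w =
    ((1 - 'X) ^+ wt s * (1 + 'X) ^+ (n - wt s) : {poly R})`_j.
Proof.
rewrite -chi_generating coef_sum [RHS](bigID (fun w => wt w == j)) /=.
rewrite [X in _ + X]big1 ?addr0; last first.
  by move=> w /negPf; rewrite coefCM coefXn eq_sym => ->; rewrite mulr0.
by apply: eq_bigr => w /eqP <-; rewrite coefCM coefXn eqxx mulr1 chiC.
Qed.

(** The coefficient of ['X^j] is the value at [i] of the Krawtchouk polynomial of degree [j]; by
    [sum_chi_level] it sums a character of weight [i] over the words of weight [j]. *)
Definition radial_eigenvalue (g : nat -> R) i : R :=
  \sum_(j < n.+1) g j * ((1 - 'X) ^+ i * (1 + 'X) ^+ (n - i) : {poly R})`_j.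

Lemma fourier_radial (g : nat -> R) s :
  fourier (fun w => g (wt w)) s = radial_eigenvalue g (wt s).
Proof.
rewrite /fourier (partition_big (fun w => inord (wt w) : 'I_n.+1) predT) //=.
apply: eq_bigr => j _; rewrite -sum_chi_level mulr_sumr.
apply: congr_big => // w.
  by rewrite -val_eqE /= inordK // ltnS wt_le.
by rewrite -val_eqE /= inordK ?ltnS ?wt_le // => /eqP ->.
Qed.

(** Substituting [y = xor x w] pulls out [chi s x]; what is left is the Fourier coefficient of the
    radial function at [s]. *)
Lemma convolution_chi (g : nat -> R) s x :
  \sum_y g (wt (xor x y)) * chi R s y = radial_eigenvalue g (wt s) * chi R s x.
Proof.
rewrite (reindex_inj (can_inj (@xorK n x))) /= -fourier_radial mulr_suml.
by apply: eq_bigr => w _; rewrite xorK chi_xor; ring.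
Qed.

(** Degree is read off the Fourier support, so it does not depend on a representing polynomial. *)
Definition fdeg_le d f := forall s, (d < wt s)%N -> fourier f s = 0.

Lemma fdeg_leZ d c f : fdeg_le d f -> fdeg_le d (fun x => c * f x).
Proof.
move=> h s hs; rewrite /fourier; under eq_bigr do rewrite -mulrA.
by rewrite -mulr_sumr [X in _ * X]h ?mulr0.
Qed.

Lemma fdeg_le_sum d (I : Type) (r : seq I) (P : pred I) (f : I -> cube n -> R) :
  (forall i, P i -> fdeg_le d (f i)) ->
  fdeg_le d (fun x => \sum_(i <- r | P i) f i x).
Proof.
move=> h s hs; rewrite /fourier; under eq_bigr do rewrite mulr_suml.
by rewrite exchange_big big1 // => i Pi; apply: h.
Qed.

Lemma fdeg_le_ext d f1 f2 : f1 =1 f2 -> fdeg_le d f1 -> fdeg_le d f2.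
Proof. by move=> e h s /h <-; apply: eq_bigr => x _; rewrite e. Qed.

(** Some coordinate of [s] is absent from the monomial, and its factor in the product is
    [-1 + 1 = 0]. *)
Lemma fdeg_le_monomial d (m : 'I_n -> nat) : (\sum_l m l <= d)%N ->
  fdeg_le d (fun x => \prod_l (x l)%:R ^+ m l).
Proof.
move=> md s hs; rewrite /fourier; under eq_bigr do rewrite -big_split /=.
rewrite (sum_cube_prod (fun l b => (b%:R : R) ^+ m l * (-1) ^+ (s l && b))).
have [l /andP[sl ml]] : exists l, s l && (m l == 0)%N.
  apply/existsP; apply: contraTT (leq_ltn_trans md hs) => /existsPn h.
  by rewrite -leqNgt; apply: leq_sum => l _; have := h l; case: (s l); case: (m l).
by rewrite (bigD1 l) //= sl (eqP ml) !(expr0, expr1); ring.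
Qed.

Lemma fdeg_le_meval d (p : {mpoly R[n]}) : (msize p <= d.+1)%N ->
  fdeg_le d (fun x => p.@[fun l => (x l)%:R]).
Proof.
move=> pd; have h : fdeg_le d (fun x => \sum_(m <- msupp p)
    p@_m * \prod_l (x l)%:R ^+ m l).
  rewrite /fdeg_le => s hs; rewrite /fourier; under eq_bigr do rewrite mulr_suml.
  rewrite exchange_big big_seq big1 //= => m mp.
  apply: (@fdeg_leZ d) hs; apply: fdeg_le_monomial.
  by rewrite -mdegE -ltnS (leq_trans _ pd) // msize_mdeg_lt.
by apply: fdeg_le_ext h => x; rewrite mevalE.
Qed.

End Fourier.

(** * Fourier multipliers, the noise operator and level bounds *)

Section Multiplier.
Variables (R : realFieldType) (n : nat).
Implicit Types (s t x y z w : cube n) (f : cube n -> R) (a : nat -> R).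

Definition multiplier a f y : R :=
  2 ^- n * \sum_s a (wt s) * fourier f s * chi R s y.

Definition multiplier_kernel a y z : R :=
  2 ^- n * \sum_s a (wt s) * chi R s z * chi R s y.

Definition level i f y : R :=
  2 ^- n * \sum_(s | wt s == i) fourier f s * chi R s y.

Lemma multiplier_kernelE a f y :
  multiplier a f y = \sum_z multiplier_kernel a y z * f z.
Proof.
rewrite /multiplier /multiplier_kernel.
under [RHS]eq_bigr do rewrite -mulrA mulr_suml.
rewrite -[RHS]mulr_sumr [in RHS]exchange_big /=; congr *%R.
apply: eq_bigr => s _; rewrite /fourier mulr_sumr mulr_suml.
by apply: eq_bigr => z _; ring.
Qed.

Lemma multiplier_levels d a f y : fdeg_le d f ->
  multiplier a f y = \sum_(i < d.+1) a i * level i f y.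
Proof.
move=> fd; rewrite /multiplier (bigID (fun s => (wt s <= d)%N)) /=.
rewrite [X in _ + X]big1 ?addr0; last first.
  by move=> s; rewrite -ltnNge => /fd ->; rewrite mulr0 mul0r.
rewrite (partition_big (fun w => inord (wt w) : 'I_d.+1) predT) //= mulr_sumr.
apply: eq_bigr => i _; rewrite /level [RHS]mulrCA [in RHS]mulr_sumr; congr (_ * _).
(* [inord] sends weights above [d] to 0, hence the explicit bound on [wt s]. *)
have h s : (wt s <= d)%N && (inord (wt s) == i) = (wt s == i).
  apply/andP/eqP => [[sd /eqP <-]|si]; first by rewrite inordK.
  by rewrite -ltnS si ltn_ord -si; split=> //; rewrite -val_eqE /= inordK ?si.
rewrite (eq_bigl _ _ h); apply: eq_bigr => s /eqP ->; by rewrite mulrA.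
Qed.

Lemma multiplier1 f y : multiplier (fun=> 1) f y = f y.
Proof.
rewrite /multiplier; under eq_bigr do rewrite mul1r.
by rewrite fourier_inversion mulKf // expf_neq0 // pnatr_eq0.
Qed.

(* The kernel of the noise operator is a product of the nonnegative factors
   [1 - rho] and [1 + rho], so the operator is an average. *)
Lemma noise_bound (rho M : R) f y : -1 <= rho <= 1 ->
  (forall x, `|f x| <= M) -> `|multiplier (fun i => rho ^+ i) f y| <= M.
Proof.
move=> /andP[rho1 rho2] fM; rewrite multiplier_kernelE.
have kE z : multiplier_kernel (fun i => rho ^+ i) y z =
    2 ^- n * \prod_l (if xor y z l then 1 - rho else 1 + rho).
  rewrite prod_if_wt -chi_noise /multiplier_kernel; congr (_ * _).
  by apply: eq_bigr => s _; rewrite chi_xor mulrA mulrAC.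
have k0 z : 0 <= multiplier_kernel (fun i => rho ^+ i) y z.
  rewrite kE mulr_ge0 ?invr_ge0 ?exprn_ge0 //.
  by apply: prodr_ge0 => l _; case: ifP => _; lra.
have k1 : \sum_z multiplier_kernel (fun i => rho ^+ i) y z = 1.
  under eq_bigr do rewrite kE; rewrite -mulr_sumr.
  rewrite (reindex_inj (can_inj (@xorK n y))) /=.
  under eq_bigr do rewrite xorK.
  rewrite (sum_cube_prod (fun _ b => if b then 1 - rho else 1 + rho)) /=.
  rewrite prodr_const card_ord.
  have -> : 1 - rho + (1 + rho) = 2 by ring.
  by rewrite mulVf // expf_neq0 // pnatr_eq0.
rewrite (le_trans (ler_norm_sum _ _ _)) // -[leRHS]mul1r -k1 mulr_suml.
by apply: ler_sum => z _; rewrite normrM ger0_norm // ler_wpM2l.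
Qed.

End Multiplier.

(** A polynomial of degree at most [d] is recovered linearly from its values at the nodes
    [j / (d + 1)], [j <= d], by inverting their Vandermonde matrix. The summand 1 in the constant
    makes it positive. *)
Lemma coef_bound (R : realFieldType) (d : nat) :
  exists2 gamma : R, 0 < gamma & forall (v : 'I_d.+1 -> R) (M : R),
    (forall rho, 0 <= rho <= 1 -> `|\sum_(i < d.+1) rho ^+ i * v i| <= M) ->
    forall i, `|v i| <= gamma * M.
Proof.
pose a : 'rV[R]_d.+1 := \row_j (j%:R / d.+1%:R).
pose V := Vandermonde d.+1 a.
have Vu : V \in unitmx.
  rewrite unitmxE unitfE det_Vandermonde.
  apply/prodf_neq0 => i _; apply/prodf_neq0 => j ij; rewrite !mxE -mulrBl.
  rewrite mulf_neq0 ?invr_eq0 ?pnatr_eq0 // subr_eq0 eqr_nat.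
  by rewrite gtn_eqF.
exists (1 + \sum_i \sum_j `|invmx V i j|).
  by rewrite ltr_pwDl // sumr_ge0 // => i _; rewrite sumr_ge0.
move=> v M hM i.
have M0 : 0 <= M by apply: le_trans (hM 0 _); rewrite // lexx ler01.
pose r : 'rV[R]_d.+1 := \row_i v i.
have rV j : `|(r *m V) 0 j| <= M.
  rewrite mxE (eq_bigr (fun i : 'I__ => a 0 j ^+ i * v i)); last first.
    by move=> k _; rewrite !mxE mulrC.
  apply: hM; rewrite mxE divr_ge0 // ler_pdivrMr ?ltr0n // mul1r ler_nat.
  by rewrite ltnW.
have -> : v i = \sum_j (r *m V) 0 j * invmx V j i.
  have /(congr1 (fun A : 'rV_d.+1 => A 0 i)) := mulmxK Vu r.
  by rewrite !mxE => <-.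
rewrite (le_trans (ler_norm_sum _ _ _)) //.
apply: (@le_trans _ _ (\sum_j M * `|invmx V j i|)).
  by apply: ler_sum => j _; rewrite normrM ler_wpM2r.
rewrite -mulr_sumr mulrC ler_wpM2r //.
apply: (@le_trans _ _ (\sum_i \sum_j `|invmx V i j|)); last by rewrite lerDr.
apply: ler_sum => j _; rewrite (bigD1 i) //= lerDl sumr_ge0 //.
Qed.

(** The levels at [y] are the coefficients in [rho] of the noise operator applied to [f], which
    [noise_bound] controls on [[0, 1]]; the constant is thus independent of [n]. *)
Lemma level_bound (R : realFieldType) (d : nat) :
  exists2 gamma : R, 0 < gamma &
    forall n (f : cube n -> R) (M : R) y i, fdeg_le d f ->
      (forall x, `|f x| <= M) -> (i <= d)%N -> `|level i f y| <= gamma * M.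
Proof.
have [gamma g0 hg] := coef_bound R d; exists gamma => // n f M y i fd fM id.
apply: (hg (fun i : 'I_d.+1 => level i f y) M _ (Ordinal (id : (i < d.+1)%N))).
move=> rho /andP[r0 r1]; rewrite -(multiplier_levels (fun i => rho ^+ i) y fd).
apply: noise_bound fM; apply/andP; split=> //; lra.
Qed.

(** * Inverting a radial convolution *)

Section Deconvolution.
Variables (R : realFieldType) (n d : nat) (g : nat -> R).
Let lam := radial_eigenvalue n g.

Lemma convolution_multiplier (f : cube n -> R) x : fdeg_le d f ->
  (forall i, (i <= d)%N -> lam i != 0) ->
  \sum_y g (wt (xor x y)) * multiplier (fun i => (lam i)^-1) f y = f x.
Proof.
move=> fd lam0; rewrite -[RHS]multiplier1 /multiplier.
under eq_bigr do rewrite mulrCA mulr_sumr.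
rewrite -mulr_sumr exchange_big /=; congr (_ * _).
(* Each character is scaled by [lam] and by its inverse; above weight [d] both sides vanish because
   [fourier f s = 0]. *)
have E s : \sum_y g (wt (xor x y)) *
    ((lam (wt s))^-1 * fourier f s * chi R s y) = 1 * fourier f s * chi R s x.
  transitivity ((lam (wt s))^-1 * fourier f s *
      \sum_y g (wt (xor x y)) * chi R s y).
    by rewrite [RHS]mulr_sumr; apply: eq_bigr => y _; ring.
  rewrite convolution_chi -/lam.
  have [sd|/fd ->] := leqP (wt s) d; last by rewrite !(mulr0, mul0r).
  by rewrite mul1r mulrACA mulVf ?mul1r // lam0.
by under eq_bigr do rewrite E.
Qed.

Lemma multiplier_perturbation (gamma delta M : R) (f : cube n -> R) y :
  fdeg_le d f ->
  (forall i, (i <= d)%N -> `|level i f y| <= gamma * M) ->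
  (forall i, (i <= d)%N -> 1 - delta <= lam i <= 1) ->
  delta <= 1 / 2 ->
  `|multiplier (fun i => (lam i)^-1) f y - f y|
     <= d.+1%:R * (2 * delta) * (gamma * M).
Proof.
move=> fd fM hlam d2; rewrite -[X in _ - X]multiplier1.
rewrite !(multiplier_levels _ _ fd) -sumrB.
rewrite (le_trans (ler_norm_sum _ _ _)) //.
rewrite -mulrA -[X in X%:R * _]card_ord mulr_natl -sumr_const ler_sum // => i _.
have id : (i <= d)%N by rewrite -ltnS.
have /andP[l1 l2] := hlam _ id.
rewrite -mulrBl normrM ler_pM ?fM //.
have l0 : 0 < lam i by lra.
rewrite ger0_norm ?subr_ge0 ?invf_ge1 //.
(* The goal is [1 <= (2 delta + 1) lam i], and [(1 + 2 delta) (1 - delta) >= 1] for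
   [0 <= delta <= 1/2]. *)
rewrite lerBlDr -[(lam i)^-1]mul1r ler_pdivrMr //; nra.
Qed.

End Deconvolution.

(** * Hamming distance as a polynomial *)

Section Distance.
Variables (R : realType) (n : nat).
Implicit Types (x y w : cube n) (p q : {poly R}) (P : {mpoly R[n]}).

Lemma natr_wt x : (wt x)%:R = \sum_l (x l)%:R :> R.
Proof. by rewrite natr_sum. Qed.

(** On bits, [a + (1 - 2 a) b] is exclusive or, so the distance to a fixed [y] is affine in [x]. *)
Definition dist_mpoly y : {mpoly R[n]} :=
  \sum_l ((y l)%:R%:MP + (1 - 2 * (y l)%:R) *: 'X_l).

Lemma dist_mpolyE x y :
  (dist_mpoly y).@[fun l => (x l)%:R] = (wt (xor x y))%:R.
Proof.
rewrite natr_wt raddf_sum; apply: eq_bigr => l _ /=.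
rewrite mevalD mevalZ mevalC mevalXU ffunE.
by case: (x l); case: (y l); rewrite /=; ring.
Qed.

Lemma msize_dist_mpoly y : (msize (dist_mpoly y) <= 2)%N.
Proof.
rewrite (leq_trans (msize_sum _ _ _)) //; apply/bigmax_leqP => l _.
rewrite (leq_trans (msizeD_le _ _)) // geq_max.
rewrite msizeC (leq_trans (msizeZ_le _ _)) ?msizeX ?mdeg1 // andbT.
by case: (_ != _).
Qed.

Definition poly_comp_mpoly q P : {mpoly R[n]} := \sum_(i < size q) q`_i *: P ^+ i.

Lemma poly_comp_mpolyE q P (v : 'I_n -> R) :
  (poly_comp_mpoly q P).@[v] = q.[P.@[v]].
Proof.
rewrite raddf_sum horner_coef; apply: eq_bigr => i _ /=.
by rewrite mevalZ rmorphXn.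
Qed.

Lemma msize_poly_comp_mpoly q P :
  (msize P <= 2)%N -> (msize (poly_comp_mpoly q P) <= size q)%N.
Proof.
move=> P2.
have hX i : (msize (P ^+ i) <= i.+1)%N.
  elim: i => [|i IH]; first by rewrite expr0 msize1.
  rewrite exprS; have [->|P0] := eqVneq P 0; first by rewrite mul0r msize0.
  have [->|PX0] := eqVneq (P ^+ i) 0; first by rewrite mulr0 msize0.
  by rewrite msizeM // -subn1 leq_subLR (leq_trans (leq_add P2 IH)).
rewrite (leq_trans (msize_sum _ _ _)) //; apply/bigmax_leqP => i _.
by rewrite (leq_trans (msizeZ_le _ _)) // (leq_trans (hX i)).
Qed.

Lemma fdeg_le_poly_wt r q : (size q <= r.+1)%N ->
  fdeg_le r (fun w => q.[(wt w)%:R]).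
Proof.
move=> qr; pose P := poly_comp_mpoly q (dist_mpoly (cube0 n)).
have : fdeg_le r (fun w => P.@[fun l => (w l)%:R]).
  apply: fdeg_le_meval; apply: leq_trans qr.
  exact: msize_poly_comp_mpoly (msize_dist_mpoly _).
apply: fdeg_le_ext => w; rewrite poly_comp_mpolyE dist_mpolyE.
by congr (_.[(wt _)%:R]); apply/ffunP => l; rewrite !ffunE addbF.
Qed.

End Distance.

(** * Krawtchouk polynomials and their orthogonality *)

Section Krawtchouk.
Variables (R : realType) (n : nat).
Implicit Types (w : cube n) (p q : {poly R}).

Lemma horner_poly_binom p i (t : R) m :
  p.[t] = m%:R -> (poly_binom p i).[t] = 'C(m, i)%:R.
Proof.
move=> pt; rewrite hornerZ horner_prod.
under eq_bigr do rewrite !hornerE pt.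
have -> : \prod_(l < i) (m%:R - l%:R) = (m ^_ i)%:R :> R.
  (* For [i > m] the factor at [l = m] is zero, as is the binomial. *)
  have [im|mi] := leqP i m; last first.
    rewrite ffact_small // (bigD1 (Ordinal mi)) //=.
    by rewrite subrr mul0r.
  rewrite ffact_prod natr_prod; apply: eq_bigr => l _.
  by rewrite natrB // ltnW // (leq_trans (ltn_ord l)).
by rewrite -bin_ffact natrM mulrCA mulVf ?mulr1 // pnatr_eq0 -lt0n fact_gt0.
Qed.

Lemma coef_1DcXn (c : R) m i : ((1 + c *: 'X) ^+ m)`_i = c ^+ i * 'C(m, i)%:R.
Proof.
rewrite exprDn coef_sum.
have E (k : 'I_m.+1) : ((1 ^+ (m - k) * (c *: 'X) ^+ k) *+ 'C(m, k))`_i =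
    (i == k)%:R * (c ^+ k * 'C(m, k)%:R).
  by rewrite expr1n mul1r exprZn coefMn coefZ coefXn -mulr_natr; ring.
rewrite (eq_bigr _ (fun k _ => E k)).
have [im|mi] := ltnP i m.+1.
  rewrite (bigD1 (Ordinal im)) //= eqxx mul1r big1 ?addr0 // => k.
  by rewrite -val_eqE eq_sym => /negPf /= ->; rewrite mul0r.
rewrite bin_small // mulr0 big1 // => k _; case: eqP => [ik|]; rewrite ?mul0r //.
by have := ltn_ord k; rewrite -ik ltnNge mi.
Qed.

(** Both sides are the coefficient of ['X^j] in [(1 - 'X) ^+ wt w * (1 + 'X) ^+ (n - wt w)]. *)
Lemma krawtchouk_wt j w : (krawtchouk R n j).[(wt w)%:R] =
  \sum_(s : cube n | wt s == j) chi R s w.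
Proof.
under eq_bigr do rewrite chiC; rewrite sum_chi_level coefM horner_sum.
apply: eq_bigr => i _; rewrite hornerZ hornerM.
rewrite (@horner_poly_binom _ _ _ (wt w)) ?hornerX //.
rewrite (@horner_poly_binom _ _ _ (n - wt w)); last first.
  by rewrite !hornerE natrB // wt_le.
have -> : 1 - 'X = 1 + (-1) *: 'X :> {poly R} by rewrite scaleN1r.
have -> : 1 + 'X = 1 + 1 *: 'X :> {poly R} by rewrite scale1r.
by rewrite !coef_1DcXn expr1n mul1r mulrA.
Qed.

Lemma size_mul_le p q i j : (size p <= i.+1)%N -> (size q <= j.+1)%N ->
  (size (p * q)%R <= (i + j).+1)%N.
Proof.
move=> hp hq; rewrite (leq_trans (size_polyMleq _ _)) //.
by rewrite -subn1 leq_subLR (leq_trans (leq_add hp hq)) // addSn addnS.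
Qed.

Lemma size_poly_binom p i : (size p <= 2)%N -> (size (poly_binom p i) <= i.+1)%N.
Proof.
move=> p2; rewrite (leq_trans (size_scale_leq _ _)) //.
elim: i => [|i IH]; first by rewrite big_ord0 size_poly1.
rewrite big_ord_recr /= -[i.+2]/((1 + i).+1) addnC; apply: size_mul_le => //.
rewrite (leq_trans (size_polyD _ _)) // geq_max p2 size_polyN.
by rewrite (leq_trans (size_polyC_leq1 _)).
Qed.

Lemma size_krawtchouk j : (size (krawtchouk R n j) <= j.+1)%N.
Proof.
apply: (leq_trans (size_sum _ _ _)); apply/bigmax_leqP => i _.
rewrite (leq_trans (size_scale_leq _ _)) //.
have h1 := @size_poly_binom 'X i (eq_leq (size_polyX _)).
have /(size_poly_binom (j - i)) h2 : (size ((n%:R)%:P - 'X : {poly R})%R <= 2)%N.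
  rewrite (leq_trans (size_polyD _ _)) // geq_max size_polyN size_polyX andbT.
  by rewrite (leq_trans (size_polyC_leq1 _)).
by rewrite (leq_trans (size_mul_le h1 h2)) // subnKC // -ltnS.
Qed.

(** Only the term [i = 0] survives at 0, leaving ['C(n, j)]. *)
Lemma krawtchouk_at0_gt0 j : (j <= n)%N -> 0 < (krawtchouk R n j).[0].
Proof.
move=> jn; rewrite horner_sum big_ord_recl big1 ?addr0.
  rewrite hornerZ hornerM expr0 mul1r subn0.
  rewrite (@horner_poly_binom _ 0 _ 0) ?hornerX //.
  rewrite (@horner_poly_binom _ j _ n) ?hornerE ?subr0 //.
  by rewrite ltr0n bin_gt0.
move=> i _; rewrite hornerZ hornerM (@horner_poly_binom _ _ _ 0) ?hornerX //.
by rewrite bin0n mul0r mulr0.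
Qed.

(** By [krawtchouk_wt] this is a sum of Fourier coefficients of weight [r + 1] of a function of
    degree at most [r]. *)
Lemma krawtchouk_orth r q : (size q <= r.+1)%N ->
  \sum_(w : cube n) q.[(wt w)%:R] * (krawtchouk R n r.+1).[(wt w)%:R] = 0.
Proof.
move=> qr; under eq_bigr do rewrite krawtchouk_wt mulr_sumr.
rewrite exchange_big big1 //= => s /eqP hs.
by apply: (fdeg_le_poly_wt qr); rewrite hs.
Qed.

End Krawtchouk.

(** Splitting off linear factors, by induction on the size, produces a least root, which the infimum
    must equal. *)
Lemma root_inf (R : realType) (p : {poly R}) a : p != 0 -> root p a ->
  root p (reals.inf [set t | root p t]%classic).
Proof.
move=> p0 pa.
have [b pb hb] : exists2 b, root p b & forall c, root p c -> b <= c.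
  have [m] := ubnP (size p); elim: m p p0 a pa => // m IH p p0 a pa pm.
  have /factor_theorem[q pq] := pa.
  have q0 : q != 0 by apply: contraNneq p0 => q0; rewrite pq q0 mul0r.
  have [[b qb]|noq] := pselect (exists b, root q b).
    have [|b0 qb0 hb0] := IH q q0 b qb.
      by move: pm; rewrite pq size_Mmonic ?monicXsubC // size_XsubC addn2.
    exists (Num.min a b0).
      by case: (leP a b0) => _ //; rewrite pq rootM qb0.
    move=> c; rewrite pq rootM root_XsubC ge_min => /orP[/hb0 ->|/eqP ->].
      by rewrite orbT.
    by rewrite lexx.
  exists a => // c; rewrite pq rootM root_XsubC => /orP[qc|/eqP ->] //.
  by case: noq; exists c.
suff -> : reals.inf [set t | root p t]%classic = b by [].
apply/eqP; rewrite eq_le; apply/andP; split.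
  by apply: ge_inf => //; exists b => c /hb.
by apply: lb_le_inf; [exists b|move=> c /hb].
Qed.

(** * The least root and the optimal kernel *)

Section Kernel.
Variables (R : realType) (n r : nat).
Hypothesis rn : (r < n)%N.
Let K := krawtchouk R n r.+1.
Let xi := kraw_root R n r.+1.

(** Orthogonality to the constant 1 forces a nonpositive value at some weight, while [K.[0]] is
    positive; the intermediate value theorem gives a root. *)
Lemma root_kraw_root : root K xi.
Proof.
have K0 : 0 < K.[0] by exact: krawtchouk_at0_gt0.
have Kn0 : K != 0 by apply: contraTneq K0 => ->; rewrite horner0 ltxx.
have [w Kw] : exists w : cube n, K.[(wt w)%:R] <= 0.
  apply/not_existsP => h.
  have := @krawtchouk_orth R n r 1; rewrite size_poly1 => /(_ isT) /eqP.
  apply/negP; rewrite gt_eqF // (bigD1 (cube0 n)) //= ltr_pwDl //.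
    by rewrite wt_cube0 hornerC mul1r.
  apply: sumr_ge0 => w _; rewrite hornerC mul1r ltW // ltNge.
  exact/negP/h.
have [|a _ ra] := @poly_ivt R (- K) 0 (wt w)%:R (ler0n _ _).
  by rewrite !hornerN !oppr_ge0 oppr_le0 Kw ltW.
by apply: (root_inf Kn0 (a := a)); rewrite -rootN.
Qed.

(* [K / (X - xi)], normalized: its square integrates [X - xi] to zero because
   [K] is orthogonal to polynomials of degree at most [r]. *)
Lemma optimal_kernel : exists2 q : {poly R}, (size q <= r.+1)%N &
  \sum_(w : cube n) q.[(wt w)%:R] ^+ 2 = 1 /\
  \sum_(w : cube n) q.[(wt w)%:R] ^+ 2 * (wt w)%:R = xi.
Proof.
have /factor_theorem[q Kq] := root_kraw_root.
have K0 : 0 < K.[0] by exact: krawtchouk_at0_gt0.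
have Kn0 : K != 0 by apply: contraTneq K0 => ->; rewrite horner0 ltxx.
have q0 : q != 0 by apply: contraNneq Kn0 => q0; rewrite Kq q0 mul0r.
have qr : (size q <= r.+1)%N.
  have := @size_krawtchouk R n r.+1.
  by rewrite -/K Kq size_Mmonic ?monicXsubC // size_XsubC addn2.
pose Z := \sum_(w : cube n) q.[(wt w)%:R] ^+ 2.
have Z0 : 0 < Z.
  rewrite /Z (bigD1 (cube0 n)) //= ltr_pwDl //; last first.
    by apply: sumr_ge0 => w _; rewrite sqr_ge0.
  rewrite wt_cube0 exprn_even_gt0 //=.
  by apply: contraTneq K0; rewrite Kq hornerM => ->; rewrite mul0r ltxx.
have orth : \sum_(w : cube n) q.[(wt w)%:R] ^+ 2 * (wt w)%:R = xi * Z.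
  apply/eqP; rewrite -subr_eq0 mulr_sumr -sumrB; apply/eqP.
  rewrite -[RHS](@krawtchouk_orth R n r q qr) -/K Kq; apply: eq_bigr => w _.
  by rewrite hornerM hornerXsubC; ring.
exists ((Num.sqrt Z)^-1 *: q); first by rewrite (leq_trans (size_scale_leq _ _)).
have E w : ((Num.sqrt Z)^-1 *: q).[(wt w)%:R] ^+ 2 = Z^-1 * q.[(wt w)%:R] ^+ 2
  by rewrite hornerZ exprMn exprVn sqr_sqrtr ?ltW.
split.
  by under eq_bigr do rewrite E; rewrite -mulr_sumr mulVf ?gt_eqF.
under eq_bigr do rewrite E -[_ * _ * _]mulrA; rewrite -mulr_sumr.
by rewrite orth mulrCA mulVf ?gt_eqF ?mulr1.
Qed.

End Kernel.

(** * Eigenvalues of a radial probability kernel *)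

Section Eigenvalues.
Variables (R : realFieldType) (n : nat) (g : nat -> R).
Hypothesis g_ge0 : forall i, 0 <= g i.
Hypothesis g_sum : \sum_(w : cube n) g (wt w) = 1.
Let lam := radial_eigenvalue n g.
Implicit Types (s w : cube n).

Lemma subr1_radial_eigenvalue s :
  1 - lam (wt s) = \sum_(w : cube n) g (wt w) * (1 - chi R s w).
Proof.
rewrite /lam -fourier_radial -[X in X - _]g_sum -sumrB.
by apply: eq_bigr => w _; rewrite mulrBr mulr1.
Qed.

Lemma norm_chi s w : `|chi R s w| = 1.
Proof.
by rewrite normr_prod big1 // => l _; rewrite normrX normrN1 expr1n.
Qed.

(** If [s] and [w] share no coordinate the left side is 0; otherwise it is at most 2 and the right
    side at least 2. *)
Lemma subr1_chi_le s w : 1 - chi R s w <= 2 * \sum_l (s l && w l)%:R.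
Proof.
have [l0 sw|h] := pickP (fun l => s l && w l); last first.
  rewrite /chi big1; last by move=> l _; rewrite h.
  by rewrite subrr mulr_ge0 // sumr_ge0.
have : 1 <= \sum_l (s l && w l)%:R :> R.
  by rewrite (bigD1 l0) //= sw lerDl sumr_ge0.
have := ler_norm (- chi R s w); rewrite normrN norm_chi.
by lra.
Qed.

Definition cube_unit (l : 'I_n) : cube n := [ffun k => k == l].

Lemma wt_cube_unit l : wt (cube_unit l) = 1%N.
Proof.
rewrite /wt (bigD1 l) //= ffunE eqxx big1 // => k /negPf kl.
by rewrite ffunE kl.
Qed.

Lemma chi_cube_unit l w : 1 - chi R (cube_unit l) w = 2 * (w l)%:R.
Proof.
rewrite /chi (bigD1 l) //= ffunE eqxx /= big1 ?mulr1.
  by case: (w l); rewrite /= ?(expr0, expr1); ring.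
by move=> k /negPf kl; rewrite ffunE kl.
Qed.

(** The character of a unit word reads a single coordinate; [g] being radial, all coordinates have
    the same mean. *)
Lemma sum_coord l : 2 * \sum_(w : cube n) g (wt w) * (w l)%:R = 1 - lam 1.
Proof.
rewrite -[X in lam X](wt_cube_unit l) subr1_radial_eigenvalue mulr_sumr.
by apply: eq_bigr => w _; rewrite chi_cube_unit mulrCA.
Qed.

Lemma sum_wt : 2 * \sum_(w : cube n) g (wt w) * (wt w)%:R = n%:R * (1 - lam 1).
Proof.
under eq_bigr do rewrite natr_sum mulr_sumr.
rewrite exchange_big mulr_sumr /=; under eq_bigr do rewrite sum_coord.
by rewrite sumr_const card_ord mulr_natl.
Qed.

Lemma exists_wt i : (i <= n)%N -> exists s : cube n, wt s = i.
Proof.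
move=> hi; exists [ffun l : 'I_n => (l < i)%N].
rewrite /wt; under eq_bigr do rewrite ffunE.
rewrite -big_mkcond /= -(big_ord_widen _ (fun=> 1%N)) //.
by rewrite sum1_card card_ord.
Qed.

(** The upper bound is [chi <= 1]. The lower one is a union bound: each of the [i] coordinates of
    [s] costs [1 - lam 1]. *)
Lemma radial_eigenvalue_bounds i : (i <= n)%N ->
  1 - i%:R * (1 - lam 1) <= lam i <= 1.
Proof.
move=> /exists_wt[s <-]; apply/andP; split; last first.
  rewrite -subr_ge0 subr1_radial_eigenvalue sumr_ge0 // => w _.
  rewrite mulr_ge0 // subr_ge0.
  by rewrite -(norm_chi s w) ler_norm.
rewrite lerBlDr -lerBlDl subr1_radial_eigenvalue.
apply: (@le_trans _ _ (\sum_(w : cube n) g (wt w) * (2 * \sum_l (s l && w l)%:R))).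
  by apply: ler_sum => w _; rewrite ler_wpM2l // subr1_chi_le.
under eq_bigr do rewrite mulrCA mulr_sumr.
rewrite -mulr_sumr exchange_big natr_sum mulr_sumr mulr_suml /=.
apply: ler_sum => l _; rewrite -(sum_coord l).
case: (s l) => /=; first by rewrite mul1r.
by rewrite big1 ?mulr0 ?mul0r // => w _; rewrite mulr0.
Qed.

End Eigenvalues.

(** * Positive semidefinite forms and rank-one decompositions *)

Section QuadraticForms.
Variables (R : realFieldType) (k : nat).
Implicit Types (A : 'M[R]_k) (u v w : 'cV[R]_k).

Definition bform A u v : R := (u^T *m A *m v) 0 0.

Definition sqnorm v : R := \sum_i v i 0 ^+ 2.

Definition psd A := forall v, 0 <= bform A v v.

Lemma bformE A u v : bform A u v = \sum_i \sum_j u i 0 * A i j * v j 0.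
Proof.
rewrite /bform mxE exchange_big /=; apply: eq_bigr => j _.
by rewrite mxE mulr_suml; apply: eq_bigr => i _; rewrite mxE.
Qed.

Lemma bform_sym A u v : A^T = A -> bform A u v = bform A v u.
Proof.
move=> As; transitivity ((u^T *m A *m v)^T 0 0); first by rewrite mxE.
by rewrite !trmx_mul trmxK As mulmxA.
Qed.

Lemma bformBB A u v t : A^T = A ->
  bform A (u - t *: v) (u - t *: v) =
    bform A u u - 2 * t * bform A u v + t ^+ 2 * bform A v v.
Proof.
move=> As; have E : bform A v u = bform A u v by rewrite bform_sym.
have -> : bform A (u - t *: v) (u - t *: v) = bform A u u - t * bform A u v
    - t * bform A v u + t ^+ 2 * bform A v v; last by rewrite E; ring.
have T : (u - t *: v)^T = u^T - t *: v^T by apply/matrixP => i j; rewrite !mxE.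
rewrite /bform T !mulmxBl !mulmxBr -!scalemxAl -!scalemxAr.
rewrite -!mulmxA; set x := u^T *m _; set y := u^T *m _; set z := v^T *m _.
by set s := v^T *m _; rewrite !mxE; ring.
Qed.

Lemma bform1 v : bform 1%:M v v = sqnorm v.
Proof.
rewrite /bform mulmx1 mxE; apply: eq_bigr => i _.
by rewrite mxE expr2.
Qed.

Lemma bformZZ A v t : bform A (t *: v) (t *: v) = t ^+ 2 * bform A v v.
Proof.
rewrite /bform [_^T]linearZ /= -!scalemxAl -scalemxAr.
by set s := _ *m v; rewrite !mxE; ring.
Qed.

Lemma bform_subl A B u v : bform (A - B) u v = bform A u v - bform B u v.
Proof. by rewrite /bform mulmxBr mulmxBl !mxE. Qed.

Lemma bform_scalar a v : bform a%:M v v = a * sqnorm v.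
Proof.
by rewrite -bform1 /bform mul_mx_scalar mulmx1 -scalemxAl mxE.
Qed.

Lemma bform_delta A i j : bform A (delta_mx i 0) (delta_mx j 0) = A i j.
Proof. by rewrite /bform trmx_delta -rowE -colE !mxE. Qed.

Lemma sqnorm_ge0 v : 0 <= sqnorm v.
Proof. by apply: sumr_ge0 => i _; rewrite sqr_ge0. Qed.

Lemma sqnorm_eq0 v : (sqnorm v == 0) = (v == 0).
Proof.
apply/idP/eqP => [|->]; last first.
  by rewrite /sqnorm big1 // => i _; rewrite mxE expr0n.
rewrite psumr_eq0 => [/allP h|i _]; last exact: sqr_ge0.
apply/matrixP => i j; rewrite ord1 mxE; apply/eqP.
by rewrite -sqrf_eq0; apply: h; rewrite mem_index_enum.
Qed.

Lemma psd1 : psd 1%:M.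
Proof. by move=> v; rewrite bform1 sqnorm_ge0. Qed.

Lemma psd_CauchySchwarz A u v : A^T = A -> psd A ->
  bform A u v ^+ 2 <= bform A u u * bform A v v.
Proof.
move=> As Ap; have h t : 0 <= _ := Ap (u - t *: v).
have [v0|v0] := eqVneq (bform A v v) 0; last first.
  have vp : 0 < bform A v v by rewrite lt_def v0 Ap.
  (* This [t] minimizes the quadratic [bform A (u - t v) (u - t v)]. *)
  have := h (bform A u v / bform A v v); rewrite bformBB //.
  set a := bform A u u; set b := bform A u v; set c := bform A v v in v0 vp *.
  have -> : a - 2 * (b / c) * b + (b / c) ^+ 2 * c = a - b ^+ 2 / c by field.
  by rewrite subr_ge0 ler_pdivrMr.
rewrite v0 mulr0; have [->|b0] := eqVneq (bform A u v) 0; first by rewrite expr0n.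
(* The form is now affine in [t], and this [t] gives it the value -1, a contradiction. *)
have := h ((bform A u u + 1) / (2 * bform A u v)).
rewrite bformBB // v0 mulr0 addr0.
set a := bform A u u; set b := bform A u v in b0 *.
have -> : a - 2 * ((a + 1) / (2 * b)) * b = -1 by field.
by rewrite oppr_ge0 ler10.
Qed.

(* The Schur complement of a nonzero diagonal entry is positive semidefinite
   and has one more zero on the diagonal. *)
Lemma psd_sum_rank1 A : A^T = A -> psd A ->
  exists s : seq ('M[R]_(k, 1) * R), all (fun p => 0 <= p.2) s /\
    A = \sum_(p <- s) p.2 *: (p.1 *m p.1^T).
Proof.
have [m] := ubnP #|[set i | A i i != 0]|.
elim: m A => // m IH A hm As Ap.
(* By Cauchy-Schwarz a zero diagonal entry kills its whole row. *)
have dz i j : A i i = 0 -> A i j = 0.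
  move=> Aii; apply/eqP; rewrite -sqrf_eq0 eq_le sqr_ge0 andbT.
  have := psd_CauchySchwarz (delta_mx i 0) (delta_mx j 0) As Ap.
  by rewrite !bform_delta Aii mul0r.
have [i /= Aii|h] := pickP (fun i => A i i != 0); last first.
  exists [::]; split=> //; rewrite big_nil; apply/matrixP => i j; rewrite mxE.
  by apply: dz; apply/eqP; rewrite -[_ == _]negbK h.
have Ai0 : 0 < A i i by rewrite lt_def Aii -bform_delta Ap.
pose B := A - (A i i)^-1 *: (col i A *m (col i A)^T).
have BE a b : B a b = A a b - (A i i)^-1 * (A a i * A b i).
  by rewrite !mxE big_ord1 !mxE.
have Bs : B^T = B.
  apply/matrixP => a b; rewrite mxE !BE (mulrC (A b i)); congr (_ - _).
  by rewrite -{1}As mxE.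
have Bp : psd B.
  (* Minimizing the form of [A] along [v - t e_i] gives exactly the form of [B] at [v]. *)
  move=> v; have := Ap (v - (bform A v (delta_mx i 0) / A i i) *: delta_mx i 0).
  rewrite bformBB // bform_delta; set b := bform A v (delta_mx i 0).
  suff -> : bform B v v = bform A v v - b ^+ 2 / A i i.
    by congr (0 <= _); field.
  rewrite bform_subl; congr (_ - _).
  have bE : b = \sum_j v j 0 * A j i.
    by rewrite /b /bform -mulmxA -colE mxE; apply: eq_bigr => j _; rewrite !mxE.
  rewrite bformE bE expr2 mulr_suml mulr_suml; apply: eq_bigr => a _.
  rewrite mulr_sumr mulr_suml; apply: eq_bigr => c _.
  by rewrite !mxE big_ord1 !mxE; ring.
have [|s [s0 sE]] := IH B _ Bs Bp.
  rewrite -ltnS (leq_trans _ hm) // ltnS; apply: proper_card.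
  apply/properP; split.
    apply/fintype.subsetP => a; rewrite !inE BE.
    by apply: contraNneq => Aa; rewrite (dz a i) // Aa !mul0r mulr0 subrr.
  exists i; rewrite !inE // BE; apply/negPn/eqP.
  by rewrite mulKf // subrr.
exists ((col i A, (A i i)^-1) :: s); split; first by rewrite /= invr_ge0 ltW.
by rewrite big_cons -sE /= addrC subrK.
Qed.

End QuadraticForms.

Lemma psd_factor (R : rcfType) (k : nat) (A : 'M[R]_k) : A^T = A -> psd A ->
  exists s : seq 'cV[R]_k, A = \sum_(u <- s) u *m u^T.
Proof.
move=> As /(psd_sum_rank1 As)[s [s0 ->]].
exists [seq Num.sqrt p.2 *: p.1 | p <- s]; rewrite big_map.
rewrite !big_seq; apply: eq_bigr => p /(allP s0) p0.
by rewrite [(_ *: _)^T]linearZ /= -scalemxAl -scalemxAr scalerA -expr2 sqr_sqrtr.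
Qed.

(** * Rayleigh quotients, least eigenvalue and spectral norm *)

Section UnitVectors.
Variables (R : realType) (k : nat).
Implicit Types (A : 'M[R]_k) (u v w : 'cV[R]_k).

Lemma enormE v : enorm v = Num.sqrt (sqnorm v).
Proof. by []. Qed.

Lemma bform_unit_ge A a : (forall v, sqnorm v = 1 -> a <= bform A v v) ->
  forall v, a * sqnorm v <= bform A v v.
Proof.
move=> h v; have [v0|v0] := eqVneq (sqnorm v) 0.
  have /eqP -> : v == 0 by rewrite -sqnorm_eq0 v0.
  by rewrite -bform_scalar /bform !mulmx0.
have vp : 0 < sqnorm v by rewrite lt_def v0 sqnorm_ge0.
pose t := Num.sqrt (sqnorm v).
have t2 : t ^+ 2 = sqnorm v by rewrite sqr_sqrtr // ltW.
have t0 : t != 0 by rewrite -sqrf_eq0 t2.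
have /h : sqnorm (t^-1 *: v) = 1.
  by rewrite -bform1 bformZZ bform1 -t2 -exprMn mulVf // expr1n.
by rewrite bformZZ exprVn t2 mulrC ler_pdivlMr.
Qed.

Lemma unit_coord_le1 v i : sqnorm v = 1 -> `|v i 0| <= 1.
Proof.
move=> v1; rewrite -sqrtr_sqr -sqrtr1 ler_wsqrtr //.
by rewrite -v1 /sqnorm (bigD1 i) //= lerDl sumr_ge0 // => j _; rewrite sqr_ge0.
Qed.

(** Crude entrywise bounds, here and in [enorm_unit_bound], keep infima and suprema over unit
    vectors finite. *)
Lemma bform_unit_bound A v : sqnorm v = 1 ->
  `|bform A v v| <= \sum_i \sum_j `|A i j|.
Proof.
move=> v1; rewrite bformE (le_trans (ler_norm_sum _ _ _)) // ler_sum // => i _.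
rewrite (le_trans (ler_norm_sum _ _ _)) // ler_sum // => j _.
rewrite !normrM -[leRHS]mulr1 ler_pM ?mulr_ge0 ?unit_coord_le1 //.
by rewrite -[leRHS]mul1r ler_wpM2r // unit_coord_le1.
Qed.

Lemma enorm_unit_bound A v : sqnorm v = 1 ->
  enorm (A *m v) <= Num.sqrt (\sum_i (\sum_j `|A i j|) ^+ 2).
Proof.
move=> v1; apply: ler_wsqrtr; apply: ler_sum => i _.
rewrite -[X in X <= _]real_normK ?num_real // ler_pXn2r ?nnegrE //; last first.
  by rewrite sumr_ge0.
rewrite mxE (le_trans (ler_norm_sum _ _ _)) // ler_sum // => j _.
by rewrite normrM -[leRHS]mulr1 ler_wpM2l // unit_coord_le1.
Qed.

End UnitVectors.

Section Spectrum.
Variables (R : realType) (k : nat).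
Implicit Types (A : 'M[R]_k) (v : 'cV[R]_k).

Lemma enorm_eq1 v : enorm v = 1 <-> sqnorm v = 1.
Proof.
rewrite enormE; split=> [h|->]; last by rewrite sqrtr1.
by rewrite -(sqr_sqrtr (sqnorm_ge0 v)) h expr1n.
Qed.

(* The infimum [mu] of the Rayleigh quotient is an eigenvalue: were [A - mu]
   invertible, Cauchy-Schwarz for the semidefinite form [A - mu] would bound
   it below by a positive constant on unit vectors. *)
Lemma lambda_min_le A v : A^T = A -> sqnorm v = 1 ->
  lambda_min A <= bform A v v.
Proof.
move=> As v1.
pose Q := [set bform A u u | u in [set u : 'cV[R]_k | sqnorm u = 1]]%classic.
have Qlb : has_lbound Q.
  exists (- \sum_i \sum_j `|A i j|) => _ [u u1 <-].
  by have := bform_unit_bound A u1; rewrite ler_norml => /andP[].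
pose mu := reals.inf Q.
have muP u : sqnorm u = 1 -> mu <= bform A u u.
  by move=> u1; apply: ge_inf => //; exists u.
have Bs : (A - mu%:M)^T = A - mu%:M by rewrite linearB /= As tr_scalar_mx.
have Bp : psd (A - mu%:M).
  by move=> u; rewrite bform_subl bform_scalar subr_ge0 bform_unit_ge.
apply: le_trans (muP v v1); apply: ge_inf.
  (* The spectrum is bounded below by [mu]: the Rayleigh quotient of an eigenvector, here a row, is
     its eigenvalue. *)
  exists mu => a /= /eigenvalueP[u uA u0].
  have tu0 : u^T != 0 by rewrite -(trmx0 _ _) (inj_eq trmx_inj).
  have up : 0 < sqnorm u^T by rewrite lt_def sqnorm_eq0 tu0 sqnorm_ge0.
  rewrite -(ler_pM2r up) (le_trans (bform_unit_ge muP _)) //.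
  rewrite /bform trmxK uA -scalemxAl mxE -bform1 /bform trmxK mulmx1 //.
rewrite /= /eigenvalue /eigenspace kermx_eq0 row_free_unit; apply/negP => Bu.
pose M := invmx (A - mu%:M).
pose D := M *m (A - mu%:M) *m M^T.
pose c := 1 + \sum_i \sum_j `|D i j|.
have c0 : 0 < c.
  by rewrite ltr_pwDl // sumr_ge0 // => i _; rewrite sumr_ge0.
have key u : sqnorm u = 1 -> mu + c^-1 <= bform A u u.
  move=> u1; have := psd_CauchySchwarz (M^T *m u) u Bs Bp.
  have -> : bform (A - mu%:M) (M^T *m u) u = 1.
    by rewrite /bform trmx_mul trmxK -(mulmxA u^T) mulVmx // -[RHS]u1 -bform1.
  have -> : bform (A - mu%:M) (M^T *m u) (M^T *m u) = bform D u u.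
    by rewrite /bform /D trmx_mul trmxK !mulmxA.
  rewrite expr1n bform_subl bform_scalar u1 mulr1 => h.
  rewrite -lerBrDl -[c^-1]mul1r ler_pdivrMr // (le_trans h) // mulrC ler_wpM2l //.
    by rewrite subr_ge0 muP.
  rewrite (le_trans (ler_norm _)) // (le_trans (bform_unit_bound _ u1)) //.
  by rewrite lerDr.
have : mu + c^-1 <= mu.
  by apply: lb_le_inf => [|_ [u u1 <-]]; [exists (bform A v v); exists v|exact: key].
by rewrite gerDl leNgt invr_gt0 c0.
Qed.

Lemma spectral_norm_ubound A :
  has_ubound [set enorm (A *m v) | v in [set v : 'cV[R]_k | enorm v = 1]]%classic.
Proof.
exists (Num.sqrt (\sum_i (\sum_j `|A i j|) ^+ 2)) => _ [v /= /enorm_eq1 v1 <-].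
exact: enorm_unit_bound.
Qed.

Lemma enorm_le_spectral_norm A v : sqnorm v = 1 ->
  enorm (A *m v) <= spectral_norm A.
Proof.
move=> v1; apply: ub_le_sup; first exact: spectral_norm_ubound.
by exists v => //=; apply/enorm_eq1.
Qed.

(** Cauchy-Schwarz for the identity form, applied to [v] and [A *m v]. *)
Lemma bform_le_spectral_norm A v : sqnorm v = 1 ->
  `|bform A v v| <= spectral_norm A.
Proof.
move=> v1; apply: le_trans (enorm_le_spectral_norm A v1).
have := psd_CauchySchwarz v (A *m v) (trmx1 _ _) (@psd1 R k).
rewrite !bform1 v1 mul1r => h; rewrite enormE -sqrtr_sqr ler_wsqrtr //.
by move: h; rewrite /bform mulmx1 mulmxA.
Qed.

Lemma spectral_norm_gt0 A : A != 0 -> 0 < spectral_norm A.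
Proof.
move=> A0; have [j Aj] : exists j, col j A != 0.
  apply/existsP; apply: contraNT A0 => /existsPn h; apply/eqP/matrixP => i j.
  have := h j; rewrite negbK => /eqP /matrixP /(_ i 0).
  by rewrite !mxE.
have u1 : sqnorm (delta_mx j 0 : 'cV[R]_k) = 1.
  by rewrite -bform1 bform_delta mxE eqxx.
apply: lt_le_trans (enorm_le_spectral_norm A u1).
by rewrite -colE enormE sqrtr_gt0 lt_def sqnorm_eq0 Aj sqnorm_ge0.
Qed.

End Spectrum.

Lemma finite_inf_le (R : realType) (T : finType) (f : T -> R) x :
  reals.inf [set f y | y in [set: T]]%classic <= f x.
Proof.
apply: ge_inf; last by exists x.
exists (- \sum_y `|f y|) => _ [y _ <-].
rewrite lerNl (bigD1 y) //= (le_trans (ler_norm _)) // normrN.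
by rewrite lerDl sumr_ge0.
Qed.

Lemma finite_sup_ge (R : realType) (T : finType) (f : T -> R) x :
  f x <= reals.sup [set f y | y in [set: T]]%classic.
Proof.
apply: ub_le_sup; last by exists x.
exists (\sum_y `|f y|) => _ [y _ <-].
rewrite (bigD1 y) //= (le_trans (ler_norm _)) //.
by rewrite lerDl sumr_ge0.
Qed.

(** * Matrix-valued multipliers and sums of squares *)

Section MatrixKernel.
Variables (R : realType) (n k : nat).
Implicit Types (F : polymx R n k k) (x y z : cube n) (v : 'cV[R]_k).

Lemma mxevalE m p (F : polymx R n m p) x :
  mxeval F x = map_mx (meval (fun l => (x l)%:R)) F.
Proof. by apply/matrixP => i j; rewrite !mxE. Qed.

Lemma mxeval_sym F x : F^T = F -> (mxeval F x)^T = mxeval F x.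
Proof. by move=> Fs; rewrite !mxevalE map_trmx Fs. Qed.

Lemma fdeg_le_mxeval F i j : fdeg_le (mxdeg F) (fun x => mxeval F x i j).
Proof.
have h : (msize (F i j) <= (mxdeg F).+1)%N.
  rewrite (leq_trans (leqSpred _)) // ltnS.
  apply: leq_trans (leq_bigmax (F := fun i => \max_(j < k) (msize (F i j)).-1) i).
  exact: (leq_bigmax (F := fun j => (msize (F i j)).-1)).
by apply: fdeg_le_ext (fdeg_le_meval h) => x; rewrite mxE.
Qed.

Lemma fdeg_le_bform F v : fdeg_le (mxdeg F) (fun x => bform (mxeval F x) v v).
Proof.
have : fdeg_le (mxdeg F)
    (fun x => \sum_i \sum_j (v i 0 * v j 0) * mxeval F x i j).
  apply: fdeg_le_sum => i _; apply: fdeg_le_sum => j _.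
  exact/fdeg_leZ/fdeg_le_mxeval.
apply: fdeg_le_ext => x; rewrite bformE; apply: eq_bigr => i _.
by apply: eq_bigr => j _; rewrite mulrAC.
Qed.

(** The scalar kernel commutes with taking entries and with [bform], which reduces matrix claims to
    scalar ones. *)
Definition mx_multiplier (a : nat -> R) F y : 'M[R]_k :=
  \sum_z multiplier_kernel a y z *: mxeval F z.

Lemma mx_multiplierE a F y i j :
  mx_multiplier a F y i j = multiplier a (fun x => mxeval F x i j) y.
Proof.
rewrite multiplier_kernelE summxE; apply: eq_bigr => z _.
by rewrite mxE.
Qed.

Lemma bform_mx_multiplier a F y v :
  bform (mx_multiplier a F y) v v =
    multiplier a (fun x => bform (mxeval F x) v v) y.
Proof.
rewrite multiplier_kernelE /bform mulmx_sumr mulmx_suml summxE.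
by apply: eq_bigr => z _; rewrite -scalemxAr -scalemxAl mxE.
Qed.

Lemma mx_multiplier_sym a F y : F^T = F ->
  (mx_multiplier a F y)^T = mx_multiplier a F y.
Proof.
move=> Fs; rewrite /mx_multiplier linear_sum /=; apply: eq_bigr => z _.
by rewrite linearZ /= mxeval_sym.
Qed.

(** Factoring [G y] as [B *m B^T], the summand at [y] is the square of [q] of the distance to [y]
    times [B], of degree at most [r] in [x]. *)
Lemma sos_kernel r (q : {poly R}) (G : cube n -> 'M[R]_k) :
  (size q <= r.+1)%N -> (forall y, (G y)^T = G y) -> (forall y, psd (G y)) ->
  exists2 S : polymx R n k k, sos r S & forall x,
    mxeval S x = \sum_y q.[(wt (xor x y))%:R] ^+ 2 *: G y.
Proof.
move=> qr Gs Gp.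
have [s sE] := choice (fun y => psd_factor (Gs y) (Gp y)).
pose N := #|{: cube n}|; pose Y (i : 'I_N) : cube n := enum_val i.
pose m (i : 'I_N) := size (s (Y i)).
pose P i := poly_comp_mpoly q (dist_mpoly R (Y i)).
pose B i : 'M[R]_(k, m i) := \matrix_(a, b) (s (Y i))`_b a 0.
have BE i : B i *m (B i)^T = G (Y i).
  rewrite sE (big_nth 0) big_mkord; apply/matrixP => a b.
  rewrite mxE summxE; apply: eq_bigr => c _.
  by rewrite !mxE big_ord1 !mxE.
pose U i : polymx R n k (m i) := P i *: map_mx (mpolyC n (R := R)) (B i).
exists (\sum_i U i *m (U i)^T).
  exists N, m, U; split=> // i; apply/bigmax_leqP => a _; apply/bigmax_leqP => b _.
  rewrite !mxE mulrC mul_mpolyC -subn1 leq_subLR (leq_trans (msizeZ_le _ _)) //.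
  exact: leq_trans (msize_poly_comp_mpoly q (msize_dist_mpoly _ _)) qr.
move=> x; rewrite mxevalE raddf_sum /=.
rewrite [RHS](reindex _ (onW_bij _ (@enum_val_bij (cube n)))) /=.
apply: eq_bigr => i _; rewrite map_mxM -map_trmx -/(Y i) -BE.
have -> : map_mx (meval (fun l => (x l)%:R)) (U i) = q.[(wt (xor x (Y i)))%:R] *: B i.
  apply/matrixP => a b; rewrite !mxE mevalM mevalC.
  by rewrite poly_comp_mpolyE dist_mpolyE.
by rewrite [(_ *: _)^T]linearZ /= -scalemxAl -scalemxAr scalerA expr2.
Qed.

End MatrixKernel.

(** * Assembling the bound *)

Lemma outer_bound_ge (R : realType) (n k r : nat) (F : polymx R n k k) l
    (S : polymx R n k k) : sos r S ->
  (forall x, mxeval F x - l%:M = mxeval S x) -> (l%:E <= outer_bound r F)%E.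
Proof. by move=> hS SE; apply: ereal_sup_ubound; exists l => //; exists S. Qed.

Lemma norm_infty_gt0 (R : realType) (n k : nat) (F : polymx R n k k) x :
  mxeval F x != 0 -> 0 < norm_infty F.
Proof.
move=> Fx; apply: lt_le_trans (spectral_norm_gt0 Fx) _.
exact: (finite_sup_ge (fun x => spectral_norm (mxeval F x))).
Qed.

Lemma Fmin_le_bform (R : realType) (n k : nat) (F : polymx R n k k) x v :
  F^T = F -> sqnorm v = 1 -> Fmin F <= bform (mxeval F x) v v.
Proof.
move=> Fs v1; apply: le_trans (lambda_min_le (mxeval_sym x Fs) v1).
exact: (finite_inf_le (fun x => lambda_min (mxeval F x))).
Qed.

Lemma bform_le_norm_infty (R : realType) (n k : nat) (F : polymx R n k k) x v :
  sqnorm v = 1 -> `|bform (mxeval F x) v v| <= norm_infty F.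
Proof.
move=> v1; apply: le_trans (bform_le_spectral_norm _ v1) _.
exact: (finite_sup_ge (fun x => spectral_norm (mxeval F x))).
Qed.

(** The mean weight under the optimal kernel is the least root, so [sum_wt] gives [1 - lam 1] as
    twice the root over [n]. *)
Lemma kraw_eigenvalue_kernel (R : realType) (n r : nat) : (r < n)%N ->
  exists2 q : {poly R}, (size q <= r.+1)%N &
    let g j := q.[j%:R] ^+ 2 in
    \sum_(w : cube n) g (wt w) = 1 /\
    forall i, (i <= n)%N ->
      1 - i%:R * (2 * (kraw_root R n r.+1 / n%:R)) <= radial_eigenvalue n g i <= 1.
Proof.
move=> rn; have [q qr [q1 qxi]] := optimal_kernel R rn; exists q => // g.
split=> // i hi; have g0 j : 0 <= g j by rewrite sqr_ge0.
have := @radial_eigenvalue_bounds R n g g0 q1 i hi.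
have := @sum_wt R n g q1; rewrite qxi => E.
have n0 : n%:R != 0 :> R by rewrite pnatr_eq0 -lt0n (leq_ltn_trans _ rn).
suff -> : 1 - radial_eigenvalue n g 1 = 2 * (kraw_root R n r.+1 / n%:R) by [].
by apply: (mulfI n0); rewrite -E; field.
Qed.

Theorem theorem6 (R : realType) (d : nat) :
  exists2 C : R, 0 < C &
    forall (n k r : nat) (F : polymx R n k k),
      (d <= n)%N -> (1 <= n)%N -> (1 <= k)%N ->
      F^T = F -> mxdeg F = d ->
      (exists x : cube n, mxeval F x != 0) ->
      r.+1%:R / n%:R <= 1 / 2 :> R ->
      (d * d.+1)%:R * (kraw_root R n r.+1 / n%:R) <= 1 / 2 ->
      (((Fmin F)%:E - outer_bound r F) / (norm_infty F)%:E
        <= (2 * C * (kraw_root R n r.+1 / n%:R))%:E)%E.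
Proof.
have [gamma gamma0 hgamma] := level_bound R d.
(* Chosen so that [eps] dominates the error of [multiplier_perturbation] at [delta = 2 d xi]; the 1
   keeps [C] positive when [d = 0]. *)
pose C := (d.+1 * (2 * d))%:R * gamma + 1.
have C0 : 0 < C by rewrite ltr_wpDl // mulr_ge0 // ltW.
exists C => // n k r F dn n0 k0 Fs Fd [x0 Fx0] rn hxi.
have rltn : (r < n)%N.
  have : r.+1%:R <= n%:R :> R.
    have np : 0 < n%:R :> R by rewrite ltr0n.
    by move: rn; rewrite ler_pdivrMr //; lra.
  by rewrite ler_nat.
have [q qr [q1 hlam]] := kraw_eigenvalue_kernel R rltn.
set xi := kraw_root R n r.+1 / n%:R in hxi hlam *.
pose g (j : nat) : R := q.[j%:R] ^+ 2.
pose lam := radial_eigenvalue n g.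
have xi0 : 0 <= xi.
  have /andP[h1 h2] := hlam 1%N n0.
  by move: (le_trans h1 h2); lra.
pose delta := d%:R * (2 * xi).
have delta2 : delta <= 1 / 2.
  (* Uses [2 d <= d (d + 1)], which also holds at [d = 0]. *)
  apply: le_trans hxi; rewrite /delta mulrA -natrM ler_wpM2r // ler_nat leq_mul2l.
  by case: (d).
have hlam' i : (i <= d)%N -> 1 - delta <= lam i <= 1.
  move=> id; have /andP[h1 h2] := hlam i (leq_trans id dn).
  apply/andP; split=> //; apply: le_trans h1.
  by rewrite lerB // ler_wpM2r ?ler_nat // mulr_ge0.
have lam0 i : (i <= d)%N -> lam i != 0.
  by move=> /hlam' /andP[h _]; rewrite gt_eqF //; lra.
pose M := norm_infty F.
have M0 : 0 < M := norm_infty_gt0 Fx0.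
pose eps := 2 * C * xi * M.
pose G y := mx_multiplier (fun i => (lam i)^-1) F y - (Fmin F - eps)%:M.
have Gs y : (G y)^T = G y.
  by rewrite /G linearB /= mx_multiplier_sym // tr_scalar_mx.
(* Along a fixed unit vector [F] becomes a scalar function of degree [d] bounded by [M], so the
   error does not depend on [k]. *)
have Gp y : psd (G y).
  move=> v; rewrite /G bform_subl bform_scalar subr_ge0; move: v.
  apply: bform_unit_ge => v v1; rewrite bform_mx_multiplier.
  pose f x := bform (mxeval F x) v v.
  have fd : fdeg_le d f by rewrite -Fd; apply: fdeg_le_bform.
  have fM x : `|f x| <= M by apply: bform_le_norm_infty.
  have fl i : (i <= d)%N -> `|level i f y| <= gamma * M by apply: hgamma.
  have := multiplier_perturbation fd fl hlam' delta2.
  rewrite ler_norml -/lam -/f => /andP[h _].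
  have hF : Fmin F <= f y by apply: Fmin_le_bform.
  have he : d.+1%:R * (2 * delta) * (gamma * M) <= eps.
    rewrite /eps /C /delta !natrM.
    have -> : d.+1%:R * (2 * (d%:R * (2 * xi))) * (gamma * M) =
      2 * (d.+1%:R * (2 * d%:R) * gamma) * xi * M by ring.
    apply: ler_wpM2r; first exact: ltW.
    apply: ler_wpM2r => //; apply: ler_wpM2l => //.
    by rewrite lerDl.
  by move: h he hF; lra.
have [S hS SE] := sos_kernel qr Gs Gp.
(* Convolving [G] with [g] undoes the inverse multiplier and fixes the constant [Fmin F - eps], as
   [g] has total mass 1. *)
have hO : ((Fmin F - eps)%:E <= outer_bound r F)%E.
  apply: outer_bound_ge hS _ => x; rewrite SE /G.
  apply/matrixP => i j; rewrite summxE.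
  pose c := ((Fmin F - eps)%:M : 'M[R]_k) i j.
  pose f y := mxeval F y i j.
  have fd : fdeg_le d f by rewrite -Fd; apply: fdeg_le_mxeval.
  have GE y : (q.[(wt (xor x y))%:R] ^+ 2 *: G y) i j = g (wt (xor x y)) *
      multiplier (fun i => (lam i)^-1) f y - g (wt (xor x y)) * c.
    by rewrite mxE /G mxE [X in _ + X]mxE mx_multiplierE mulrBr.
  under eq_bigr do rewrite GE.
  rewrite sumrB (convolution_multiplier x fd lam0) -mulr_suml.
  rewrite (reindex_inj (can_inj (@xorK n x))) /=.
  by under [X in _ - X * c]eq_bigr do rewrite xorK; rewrite q1 mul1r mxE [X in _ + X]mxE.
(* If the outer bound is [+oo] the quotient is [-oo]; the value [-oo] contradicts [hO]. *)
move: hO; rewrite inver gt_eqF //.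
case: (outer_bound r F) => [o| |] /=.
- rewrite -EFinB -EFinM !lee_fin => ho.
  rewrite ler_pdivrMr // -/M -/eps; lra.
- by move=> _; rewrite mulNyr gtr0_sg ?invr_gt0 // mul1e leNye.
- by [].
Qed.
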